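(* Let $\mathbb{F}$ be a field and let $\Xi\subset\mathbb{F}^2$ be a finite nonempty set of distinct points, with horizontal lines decomposition $\Xi=\bigcup_{j=0}^{\#\pi_y(\Xi)-1}\Xi_j^x$ and vertical lines decomposition $\Xi=\bigcup_{i=0}^{\#\pi_x(\Xi)-1}\Xi_i^y$ as defined in the context. Then $\Xi$ is Cartesian if and only if $$\pi_x(\Xi_0^x)\supseteq\pi_x(\Xi_1^x)\supseteq\cdots\supseteq\pi_x(\Xi_{\#\pi_y(\Xi)-1}^x)$$ or $$\pi_y(\Xi_0^y)\supseteq\pi_y(\Xi_1^y)\supseteq\cdots\supseteq\pi_y(\Xi_{\#\pi_x(\Xi)-1}^y).$$
   Context: $\mathbb{N}_0$ is the set of nonnegative integers. A finite nonempty set $\mathcal{A}\subset\mathbb{N}_0^2$ is lower if for every $(i,j)\in\mathcal{A}$ all $(i',j')\in\mathbb{N}_0^2$ with $0\le i'\le i$, $0\le j'\le j$ belong to $\mathcal{A}$. Put $\mathrm{b}_x(\mathcal{A})=\max\{i:(i,0)\in\mathcal{A}\}$ and $\mathrm{b}_y(\mathcal{A})=\max\{j:(0,j)\in\mathcal{A}\}$. A finite nonempty set $\Xi\subset\mathbb{F}^2$ is Cartesian if there exist a lower set $\mathcal{A}\subset\mathbb{N}_0^2$ and two injective functions $\mathrm{x}:\{0,\ldots,\mathrm{b}_x(\mathcal{A})\}\to\mathbb{F}$, $\mathrm{y}:\{0,\ldots,\mathrm{b}_y(\mathcal{A})\}\to\mathbb{F}$ such that $\Xi=\{(\mathrm{x}(i),\mathrm{y}(j)):(i,j)\in\mathcal{A}\}$.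 $\pi_x,\pi_y:\mathbb{F}^2\to\mathbb{F}$ are the projections onto the first and second coordinates; $\pi_x(\Xi),\pi_y(\Xi)$ denote the images of $\Xi$. The sets $\Xi_0^y,\ldots,\Xi_{\#\pi_x(\Xi)-1}^y$ are the sets $\Xi\cap\{x=\bar x\}$, $\bar x\in\pi_x(\Xi)$, enumerated so that $\#\Xi_0^y\ge\#\Xi_1^y\ge\cdots\ge\#\Xi_{\#\pi_x(\Xi)-1}^y$; the sets $\Xi_0^x,\ldots,\Xi_{\#\pi_y(\Xi)-1}^x$ are the sets $\Xi\cap\{y=\bar y\}$, $\bar y\in\pi_y(\Xi)$, enumerated so that $\#\Xi_0^x\ge\#\Xi_1^x\ge\cdots\ge\#\Xi_{\#\pi_y(\Xi)-1}^x$ (ties broken arbitrarily). *)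

(* Defs.v *)
From mathcomp Require Import all_boot all_order all_algebra.
From mathcomp Require Import finmap.

Set Implicit Arguments.
Unset Strict Implicit.
Unset Printing Implicit Defensive.

Local Open Scope fset_scope.

Definition lower (A : {fset nat * nat}) : Prop :=
  A != fset0 /\
  forall i j : nat, (i, j) \in A ->
  forall i' j', i' <= i -> j' <= j -> (i', j') \in A.

(* For a lower set [A] both maxima range over a nonempty family, since
   [(0, 0)] belongs to [A]. *)
Definition b_x (A : {fset nat * nat}) : nat := \max_(p <- A | p.2 == 0) p.1.
Definition b_y (A : {fset nat * nat}) : nat := \max_(p <- A | p.1 == 0) p.2.

Section Points.
Variable F : choiceType.
Implicit Type X : {fset F * F}.

(* The index pairs are taken in ['I_(b_x A).+1 * 'I_(b_y A).+1]: when [A] is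
   lower this box contains [A]. *)
Definition cartesian X : Prop :=
  exists A : {fset nat * nat}, lower A /\
  exists (x : 'I_(b_x A).+1 -> F) (y : 'I_(b_y A).+1 -> F),
    [/\ injective x, injective y &
        forall p : F * F, p \in X <->
          exists i j, (nat_of_ord i, nat_of_ord j) \in A /\ p = (x i, y j)].

Definition pi_x X : {fset F} := [fset p.1 | p in X].
Definition pi_y X : {fset F} := [fset p.2 | p in X].

Definition vline X (a : F) : {fset F * F} := [fset p in X | p.1 == a].
Definition hline X (b : F) : {fset F * F} := [fset p in X | p.2 == b].

Definition vlines X : {fset {fset F * F}} := [fset vline X a | a in pi_x X].
Definition hlines X : {fset {fset F * F}} := [fset hline X b | b in pi_y X].

(* [S] lists each member of [L] exactly once, by nonincreasing cardinality;
   the order of members of equal cardinality is left free. *)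
Definition decr_enum (L : {fset {fset F * F}}) n (S : 'I_n -> {fset F * F}) :
    Prop :=
  [/\ injective S,
      forall T, T \in L <-> exists i, S i = T &
      forall i j : 'I_n, i <= j -> #|` S j| <= #|` S i|].

Definition vertical_decomposition X (S : 'I_#|` pi_x X| -> {fset F * F}) :
  Prop := decr_enum (vlines X) S.

Definition horizontal_decomposition X (S : 'I_#|` pi_y X| -> {fset F * F}) :
  Prop := decr_enum (hlines X) S.

Definition decr_chain n (P : 'I_n -> {fset F}) : Prop :=
  forall i j : 'I_n, nat_of_ord j = i.+1 -> P j `<=` P i.

End Points.

(* Main.v *)
(* Both chain conditions and Cartesianity are equivalent to one exchange
   property, which is symmetric in the two coordinates: whenever (a, b) and
   (a', b') lie in Xi, so does (a, b') or (a', b).  It says that the rows of Xi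
   are pairwise comparable for inclusion, and equally that the columns are.
   Under it, listing the abscissas by decreasing column and the ordinates by
   decreasing row turns Xi into a lower set of index pairs. *)
Require Import Defs.
From mathcomp Require Import all_boot all_order all_algebra.
From mathcomp Require Import finmap.

Local Open Scope fset_scope.

Definition exchange {F : choiceType} (X : {fset F * F}) : Prop :=
  forall a b a' b' : F, (a, b) \in X -> (a', b') \in X ->
    (a, b') \in X \/ (a', b) \in X.

Lemma in_pi_x_hline {F : choiceType} (X : {fset F * F}) a b :
  (a \in pi_x (hline X b)) = ((a, b) \in X).
Proof.
apply/imfsetP/idP => [[[a' b'] /=]|abX].
  by rewrite !inE /= => /andP[abX /eqP <-] ->.
by exists (a, b); rewrite // !inE /= abX eqxx.
Qed.

Lemma in_pi_y_vline {F : choiceType} (X : {fset F * F}) a b :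
  (b \in pi_y (Defs.vline X a)) = ((a, b) \in X).
Proof.
apply/imfsetP/idP => [[[a' b'] /=]|abX].
  by rewrite !inE /= => /andP[abX /eqP <-] ->.
by exists (a, b); rewrite // !inE /= abX eqxx.
Qed.

Lemma mem_pi_x {F : choiceType} (X : {fset F * F}) p :
  p \in X -> p.1 \in pi_x X.
Proof. by move=> pX; apply/imfsetP; exists p. Qed.

Lemma mem_pi_y {F : choiceType} (X : {fset F * F}) p :
  p \in X -> p.2 \in pi_y X.
Proof. by move=> pX; apply/imfsetP; exists p. Qed.

(** An abscissa [a] of row [b'] missing from row [b] leaves exchange only one way out against any
    [(a', b)]: the point [(a', b')]. Hence all of row [b] lies over row [b']. The relation puts the
    larger row first, so that sorting by it yields decreasing rows. *)
Lemma exchange_pi_x_hline {F : choiceType} (X : {fset F * F}) :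
  exchange X <->
  total (fun b b' : F => pi_x (hline X b') `<=` pi_x (hline X b)).
Proof.
split=> [exX b b'|totX a b a' b' abX abX'].
  apply/orP; case: (boolP (_ `<=` _)) => [|/fsubsetPn[a]]; first by left.
  rewrite !in_pi_x_hline => abX' nabX; right.
  apply/fsubsetP => a'; rewrite !in_pi_x_hline => abX.
  by case: (exX _ _ _ _ abX' abX) => // abX2; rewrite abX2 in nabX.
by case/orP: (totX b b') => /fsubsetP sub; [right|left];
  rewrite -in_pi_x_hline; apply: sub; rewrite in_pi_x_hline.
Qed.

Lemma exchange_pi_y_vline {F : choiceType} (X : {fset F * F}) :
  exchange X <->
  total (fun a a' : F => pi_y (Defs.vline X a') `<=` pi_y (Defs.vline X a)).
Proof.
split=> [exX a a'|totX a b a' b' abX abX'].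
  apply/orP; case: (boolP (_ `<=` _)) => [|/fsubsetPn[b]]; first by left.
  rewrite !in_pi_y_vline => abX' nabX; right.
  apply/fsubsetP => b'; rewrite !in_pi_y_vline => abX.
  by case: (exX _ _ _ _ abX' abX) => // abX2; rewrite abX2 in nabX.
by case/orP: (totX a a') => /fsubsetP sub; [left|right];
  rewrite -in_pi_y_vline; apply: sub; rewrite in_pi_y_vline.
Qed.

Lemma decr_chain_leq {F : choiceType} {n} {P : 'I_n -> {fset F}} :
  decr_chain P -> forall i j : 'I_n, i <= j -> P j `<=` P i.
Proof.
move=> chP i [j jn] /=; elim: j jn => [|j IHj] jn.
  rewrite leqn0 => /eqP i0.
  by rewrite (_ : Ordinal jn = i) //; apply: val_inj.
rewrite leq_eqVlt => /orP[/eqP ij|ij].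
  by rewrite (_ : Ordinal jn = i) //; apply: val_inj.
by apply: fsubset_trans (IHj (ltnW jn) ij); apply: chP.
Qed.

(** The right-hand side does not mention [S], so the order chosen among lines of equal size is
    immaterial. The projection [h] is abstract so as to serve rows and columns alike. *)
Lemma decr_enum_chainP {F : choiceType} {L : {fset {fset F * F}}} {n}
    {S : 'I_n -> {fset F * F}} {h : F * F -> F} :
  decr_enum L S -> {in L, forall T : {fset F * F}, {in T &, injective h}} ->
  decr_chain (fun i => [fset h p | p in S i]) <->
  {in L &, forall T T' : {fset F * F},
    ([fset h p | p in T'] `<=` [fset h p | p in T]) ||
    ([fset h p | p in T] `<=` [fset h p | p in T'])}.
Proof.
case=> _ SL Sdecr hinj; split=> [chS _ _ /SL[i <-] /SL[j <-]|cmpL i j ji].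
  by apply/orP; case/orP: (leq_total i j) => ij; [left|right];
    apply: (decr_chain_leq chS).
have SinL k : S k \in L by apply/SL; exists k.
(* If the inclusion goes the wrong way, it is an equality: [h] preserves the cardinality of each
   line, and [S j] is no larger than [S i]. *)
case/orP: (cmpL _ _ (SinL i) (SinL j)) => // sub.
suff /eqP -> : [fset h p | p in S i] == [fset h p | p in S j].
  exact: fsubset_refl.
rewrite eqEfcard sub !card_in_imfset /=; try exact: hinj (SinL _).
by rewrite Sdecr // ji.
Qed.

Lemma horizontal_chainP {F : choiceType} {X : {fset F * F}}
    {S : 'I_#|` pi_y X| -> {fset F * F}} :
  horizontal_decomposition S ->
  decr_chain (fun j => pi_x (S j)) <-> exchange X.
Proof.
(* On a horizontal line the ordinate is constant, so the abscissa determines the point. *)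
move=> SP; have hinj : {in hlines X, forall T : {fset F * F},
    {in T &, injective (fun p : F * F => p.1)}}.
  move=> _ /imfsetP[b _ ->] [a1 b1] [a2 b2]; rewrite !inE /=.
  by move=> /andP[_ /eqP ->] /andP[_ /eqP ->] ->.
apply: (iff_trans (decr_enum_chainP SP hinj)); split=> [cmpX a b a' b'|exX].
  move=> abX abX'.
  have lin p : p \in X -> hline X p.2 \in hlines X.
    by move=> /mem_pi_y pX; apply/imfsetP; exists p.2.
  case/orP: (cmpX _ _ (lin _ abX) (lin _ abX')) => /fsubsetP sub;
    [right|left]; rewrite -in_pi_x_hline; apply: sub;
    by rewrite -/(pi_x _) in_pi_x_hline.
move=> _ _ /imfsetP[b _ ->] /imfsetP[b' _ ->].
exact: (exchange_pi_x_hline X).1.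
Qed.

Lemma vertical_chainP {F : choiceType} {X : {fset F * F}}
    {S : 'I_#|` pi_x X| -> {fset F * F}} :
  vertical_decomposition S ->
  decr_chain (fun i => pi_y (S i)) <-> exchange X.
Proof.
move=> SP; have hinj : {in vlines X, forall T : {fset F * F},
    {in T &, injective (fun p : F * F => p.2)}}.
  move=> _ /imfsetP[a _ ->] [a1 b1] [a2 b2]; rewrite !inE /=.
  by move=> /andP[_ /eqP ->] /andP[_ /eqP ->] ->.
apply: (iff_trans (decr_enum_chainP SP hinj)); split=> [cmpX a b a' b'|exX].
  move=> abX abX'.
  have lin p : p \in X -> Defs.vline X p.1 \in vlines X.
    by move=> /mem_pi_x pX; apply/imfsetP; exists p.1.
  case/orP: (cmpX _ _ (lin _ abX) (lin _ abX')) => /fsubsetP sub;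
    [left|right]; rewrite -in_pi_y_vline; apply: sub;
    by rewrite -/(pi_y _) in_pi_y_vline.
move=> _ _ /imfsetP[a _ ->] /imfsetP[a' _ ->].
exact: (exchange_pi_y_vline X).1.
Qed.

(** Whichever first index is smaller, pairing it with the other point's second index gives a pair
    dominated by one of the two given ones. *)
Lemma cartesian_exchange {F : choiceType} (X : {fset F * F}) :
  cartesian X -> exchange X.
Proof.
case=> A [[_ lowA] [x [y [_ _ XE]]]] a b a' b'.
move=> /XE[i [j [ijA [-> ->]]]] /XE[i' [j' [ijA' [-> ->]]]].
case/orP: (leq_total i i') => ii'; [left|right]; apply/XE.
  by exists i, j'; split=> //; apply: lowA ijA' _ _ _ _.
by exists i', j; split=> //; apply: lowA ijA _ _ _ _.
Qed.

Lemma lower_leq_b_x {A : {fset nat * nat}} {i j} :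
  lower A -> (i, j) \in A -> i <= b_x A.
Proof.
case=> _ lowA ijA; have i0A := lowA _ _ ijA i 0 (leqnn i) (leq0n j).
exact: (@leq_bigmax_seq _ (enum_fset A) (fun p => p.2 == 0) (fun p => p.1) (i, 0)).
Qed.

Lemma lower_leq_b_y {A : {fset nat * nat}} {i j} :
  lower A -> (i, j) \in A -> j <= b_y A.
Proof.
case=> _ lowA ijA; have j0A := lowA _ _ ijA 0 j (leq0n i) (leqnn j).
exact: (@leq_bigmax_seq _ (enum_fset A) (fun p => p.1 == 0) (fun p => p.2) (0, j)).
Qed.

(** Reverse inclusion of sections is a total preorder on indices, which suffices for sorting even
    when distinct indices have equal sections. *)
Lemma total_section_sort {T U : choiceType} {P : T -> {fset U}} (s : seq T) :
  total (fun a a' => P a' `<=` P a) ->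
  exists2 t, perm_eq t s &
    forall x0 i j, i <= j -> j < size t -> P (nth x0 t j) `<=` P (nth x0 t i).
Proof.
set r := (fun a a' : T => P a' `<=` P a) => rtot.
have rtr : transitive r.
  by move=> a b c ab bc; apply: fsubset_trans bc ab.
have rrefl : reflexive r by move=> a; apply: fsubset_refl.
exists (sort r s) => [|x0 i j ij jt]; first by rewrite perm_sort.
apply: (sorted_leq_nth rtr rrefl x0 (sort_sorted rtot s)) => //.
by rewrite inE (leq_ltn_trans ij).
Qed.

Lemma exchange_cartesian {F : choiceType} (X : {fset F * F}) :
  X != fset0 -> exchange X -> cartesian X.
Proof.
(* This point supplies the defaults for [nth] and witnesses that both lists and [A] are nonempty. *)
move=> X0 exX; case/fset0Pn: (X0) => [[x0 y0] xyX].
have [xs xsP xsub] :=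
  total_section_sort (pi_x X) ((exchange_pi_y_vline X).1 exX).
have [ys ysP ysub] :=
  total_section_sort (pi_y X) ((exchange_pi_x_hline X).1 exX).
have xs_uniq : uniq xs by rewrite (perm_uniq xsP) fset_uniq.
have ys_uniq : uniq ys by rewrite (perm_uniq ysP) fset_uniq.
have in_xs p : p \in X -> p.1 \in xs.
  by move=> /mem_pi_x; rewrite (perm_mem xsP).
have in_ys p : p \in X -> p.2 \in ys.
  by move=> /mem_pi_y; rewrite (perm_mem ysP).
pose A : {fset nat * nat} := [fset (index p.1 xs, index p.2 ys) | p in X].
have AP i j : (i, j) \in A <->
    [/\ i < size xs, j < size ys & (nth x0 xs i, nth y0 ys j) \in X].
  split=> [/imfsetP[[a b] /= abX [-> ->]]|[ix jy ijX]].
    have /= ax := in_xs _ abX; have /= yb := in_ys _ abX.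
    by rewrite !index_mem !nth_index.
  by apply/imfsetP; exists (nth x0 xs i, nth y0 ys j); rewrite ?index_uniq.
have lowA : lower A.
  split=> [|i j /AP[ix jy ijX] i' j' ii' jj'].
    by apply/fset0Pn; exists (index x0 xs, index y0 ys); apply/imfsetP;
      exists (x0, y0).
  apply/AP; split; [exact: leq_ltn_trans ix|exact: leq_ltn_trans jy|].
  (* The path from [(i, j)] to [(i', j')] goes through [(i, j')]: first by nesting of rows, then by
     nesting of columns; the goal is treated backwards. *)
  rewrite -in_pi_y_vline; apply: (fsubsetP (xsub x0 _ _ ii' ix)).
  rewrite in_pi_y_vline -in_pi_x_hline.
  by apply: (fsubsetP (ysub y0 _ _ jj' jy)); rewrite in_pi_x_hline.
have xs_gt0 : 0 < size xs by case: (xs) (in_xs _ xyX).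
have ys_gt0 : 0 < size ys by case: (ys) (in_ys _ xyX).
(* These bounds keep the ordinals within the lists, where [nth] is injective and never returns its
   default. *)
have bxA : b_x A < size xs.
  rewrite -(prednK xs_gt0) ltnS; apply/bigmax_leqP_seq => -[i j] /AP[ix _ _] _.
  by rewrite -ltnS prednK.
have byA : b_y A < size ys.
  rewrite -(prednK ys_gt0) ltnS; apply/bigmax_leqP_seq => -[i j] /AP[_ jy _] _.
  by rewrite -ltnS prednK.
exists A; split=> //.
exists (fun i => nth x0 xs i), (fun j => nth y0 ys j); split.
- move=> i j /eqP; rewrite nth_uniq //; first by move/eqP/val_inj.
  + exact: leq_trans (ltn_ord i) bxA.
  + exact: leq_trans (ltn_ord j) bxA.
- move=> i j /eqP; rewrite nth_uniq //; first by move/eqP/val_inj.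
  + exact: leq_trans (ltn_ord i) byA.
  + exact: leq_trans (ltn_ord j) byA.
case=> a b; split=> [abX|[i [j [/AP[_ _ ijX] ->]]] //].
have ijA : (index a xs, index b ys) \in A by apply/imfsetP; exists (a, b).
have ix : index a xs < (b_x A).+1 by rewrite ltnS (lower_leq_b_x lowA ijA).
have jy : index b ys < (b_y A).+1 by rewrite ltnS (lower_leq_b_y lowA ijA).
exists (Ordinal ix), (Ordinal jy); split=> //=.
by rewrite !nth_index ?(in_xs _ abX) ?(in_ys _ abX).
Qed.

Theorem theorem2p2 (F : fieldType) (Xi : {fset F * F})
    (Xi_neq0 : Xi != fset0)
    (Xi_x : 'I_#|` pi_y Xi| -> {fset F * F})
    (Xi_y : 'I_#|` pi_x Xi| -> {fset F * F})
    (Xi_xP : horizontal_decomposition Xi_x)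
    (Xi_yP : vertical_decomposition Xi_y) :
  cartesian Xi <->
    (decr_chain (fun j => pi_x (Xi_x j)) \/
     decr_chain (fun i => pi_y (Xi_y i))).
Proof.
split=> [/cartesian_exchange exX|chX].
  (* Exchange yields either chain; the horizontal one is chosen. *)
  by left; apply/(horizontal_chainP Xi_xP).
apply: exchange_cartesian => //.
by case: chX => [/(horizontal_chainP Xi_xP)|/(vertical_chainP Xi_yP)].
Qed.
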